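(* Let $V,W$ be ordered vector spaces, let $\mathcal{P}\subseteq\mathcal{L}(V,W)$ be nonempty with $\mathcal{P}\pm\mathcal{P}\subseteq\mathcal{P}$, and let $T\in\mathcal{L}(V,W)$. (i) $T$ is an r-$\mathcal{P}$-operator if and only if $T$ is a $\mathcal{P}$-dominated $\mathcal{P}$-operator. (ii) Assume that the modulus $|T|$ of $T$ exists in $\mathcal{L}(V,W)$ and that $\mathcal{P}$-operators satisfy the domination property. Then $T$ is an r-$\mathcal{P}$-operator if and only if $|T|$ is a $\mathcal{P}$-operator.
   Context: Vector spaces are real. $\mathcal{L}(V,W)$ is the space of all linear operators from $V$ to $W$, ordered by $S\le T$ iff $T-S$ is positive. The modulus is $|T|=\sup\{T,-T\}$ in $\mathcal{L}(V,W)$. The condition $\mathcal{P}\pm\mathcal{P}\subseteq\mathcal{P}$ means that sums and differences of elements of $\mathcal{P}$ lie in $\mathcal{P}$. Elements of $\mathcal{P}$ are called $\mathcal{P}$-operators. An operator $T:V\to W$ is a regularly $\mathcal{P}$-operator (r-$\mathcal{P}$-operator) if $T$ is a difference of two positive $\mathcal{P}$-operators. An operator $T\in\mathcal{L}(V,W)$ is $\mathcal{P}$-dominated if $\pm T\le U$ for some $U\in\mathcal{P}$. $\mathcal{P}$-operators satisfy the domination property if $0\le S\le T\in\mathcal{P}$ implies $S\in\mathcal{P}$. *)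

(* Defs.v *)
From HB Require Import structures.
From mathcomp Require Import all_boot all_order all_algebra.
From mathcomp Require Import boolp classical_sets reals.
Set Implicit Arguments.
Unset Strict Implicit.
Unset Printing Implicit Defensive.
Import Order.TTheory GRing.Theory Num.Theory.
Local Open Scope ring_scope.

(* [porderZmodType] only joins a partial order with an additive group; the
   compatibility of the order with the vector space operations is added here. *)
HB.mixin Record POrderedLmodule_isOrdered (R : numDomainType) V
    of Num.POrderedZmodule V & GRing.Lmodule R V := {
  ovs_leD2r : forall z x y : V, x <= y -> x + z <= y + z;
  ovs_leZ2l : forall (a : R) (x y : V), 0 <= a -> x <= y -> a *: x <= a *: y
}.

#[short(type="orderedLmodType")]
HB.structure Definition OrderedLmodule (R : numDomainType) :=
  { V of Num.POrderedZmodule V & GRing.Lmodule R V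
         & POrderedLmodule_isOrdered R V }.

Definition positive_op (R : realType) (V W : orderedLmodType R)
    (T : {linear V -> W}) : Prop :=
  forall x : V, 0 <= x -> 0 <= T x.

(* A preorder on operators: antisymmetric when the positive cone of [V] is
   generating, but not in general. *)
Definition le_op (R : realType) (V W : orderedLmodType R)
    (S T : {linear V -> W}) : Prop :=
  positive_op (T \- S).

(* [M] is a supremum of [T] and [- T]; a relation rather than a function, as
   suprema need not exist and, for a mere preorder, need not be unique. *)
Definition is_modulus (R : realType) (V W : orderedLmodType R)
    (T M : {linear V -> W}) : Prop :=
  [/\ le_op T M, le_op (\- T) M &
      forall U : {linear V -> W}, le_op T U -> le_op (\- T) U -> le_op M U].

Definition addsub_closed (R : realType) (V W : orderedLmodType R)
    (P : set {linear V -> W}) : Prop :=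
  forall S T : {linear V -> W}, P S -> P T -> P (S \+ T) /\ P (S \- T).

Definition regular_op (R : realType) (V W : orderedLmodType R)
    (P : set {linear V -> W}) (T : {linear V -> W}) : Prop :=
  exists T1 T2 : {linear V -> W},
    [/\ P T1, positive_op T1, P T2, positive_op T2 & T = (T1 \- T2)].

Definition dominated_op (R : realType) (V W : orderedLmodType R)
    (P : set {linear V -> W}) (T : {linear V -> W}) : Prop :=
  exists U : {linear V -> W}, [/\ P U, le_op T U & le_op (\- T) U].

Definition domination_property (R : realType) (V W : orderedLmodType R)
    (P : set {linear V -> W}) : Prop :=
  forall S T : {linear V -> W}, positive_op S -> le_op S T -> P T -> P S.

(* Main.v *)
Require Import Defs.
From mathcomp Require Import all_boot all_order all_algebra.
From mathcomp Require Import boolp classical_sets reals.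
Local Open Scope classical_set_scope.
Local Open Scope ring_scope.

(** The whole argument rests on one decomposition: if [U] dominates both [T]
    and [- T], then [T = U - (U - T)], where [U - T] is positive by assumption
    and [U] is positive because [U + U = (U - T) + (U + T)]
    ([positive_dominating]).  The usual choice [(U + T) / 2 - (U - T) / 2] is
    unsuitable, since a class closed under sums and differences need not be
    closed under halving.  Conversely, positive [T1] and [T2] give the
    dominating operator [T1 + T2] of [T1 - T2] ([sub_le_add]).

    This is part (i).  For part (ii), the modulus [M] of [T1 - T2] is the least
    dominating operator, so [0 <= M <= T1 + T2] and the domination property
    applies.  In the other direction, [T = M - (M - T)] is again the required
    decomposition once [M - T] is in the class, and this follows from
    [0 <= M - T <= M + M]. *)

Import Order.TTheory GRing.Theory Num.Theory.

Set Implicit Arguments.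
Unset Strict Implicit.
Unset Printing Implicit Defensive.

Section OrderedLmodule.
Variables (R : realType) (V : orderedLmodType R).
Implicit Types x y : V.

Lemma ovs_addr_ge0 x y : 0 <= x -> 0 <= y -> 0 <= x + y.
Proof. by move=> x0 /(ovs_leD2r x); rewrite add0r addrC; apply: le_trans. Qed.

(** Halving: this is where the order has to be compatible with real scalars,
    as in a partially ordered abelian group [0 <= x + x] does not force
    [0 <= x]. *)
Lemma ovs_double_ge0 x : 0 <= x + x -> 0 <= x.
Proof.
have half_ge0 : 0 <= 2^-1 :> R by rewrite invr_ge0 ler0n.
move=> /(ovs_leZ2l _ _ _ half_ge0).
by rewrite scaler0 -mulr2n -scaler_nat scalerA mulVf ?scale1r // pnatr_eq0.
Qed.

End OrderedLmodule.

Section Operators.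
Variables (R : realType) (V W : orderedLmodType R).
Implicit Types (S T U M : {linear V -> W}) (P : set {linear V -> W}).

(** Equality of bundled operators is reduced to equality of values: the
    linearity proofs are identified by proof irrelevance. *)
Lemma linear_op_ext S T : S =1 T -> S = T.
Proof.
case: S T => [f cf] [g cg] /= /funext fg; move: cf cg; rewrite fg => cf cg.
congr GRing.Linear.Pack; case: cf cg => [[a] [b]] [[c] [d]].
by congr GRing.Linear.Class; [congr GRing.isNmodMorphism.Axioms_ |
  congr GRing.isScalable.Axioms_]; apply: Prop_irrelevance.
Qed.

Lemma positive_dominating T U : le_op T U -> le_op (\- T) U -> positive_op U.
Proof.
move=> TU NTU x x0; apply: ovs_double_ge0.
have := ovs_addr_ge0 (TU x x0) (NTU x x0).
by rewrite /= opprK addrACA addNr addr0.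
Qed.

Lemma sub_le_add S T : positive_op S -> positive_op T ->
  le_op (S \- T) (S \+ T) /\ le_op (\- (S \- T)) (S \+ T).
Proof.
move=> S0 T0; split=> x x0 /=.
  rewrite opprB addrC addrA subrK.
  by apply: ovs_addr_ge0; apply: T0.
rewrite opprK addrACA subrr addr0.
by apply: ovs_addr_ge0; apply: S0.
Qed.

Lemma regular_of_dominating P T U : P U -> P (U \- T) ->
  le_op T U -> le_op (\- T) U -> regular_op P T.
Proof.
move=> PU PUT TU NTU; exists U, (U \- T); split=> //.
  exact: positive_dominating TU NTU.
by apply: linear_op_ext => x /=; rewrite opprB addrC subrK.
Qed.

Lemma regular_dominated P T :
  addsub_closed P -> regular_op P T -> dominated_op P T.
Proof.
move=> Pcl [T1 [T2 [P1 pos1 P2 pos2 ->]]].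
by exists (T1 \+ T2); have [? ?] := sub_le_add pos1 pos2; split=> //;
  apply: (Pcl _ _ P1 P2).1.
Qed.

Lemma regular_mem P T : addsub_closed P -> regular_op P T -> P T.
Proof. by move=> Pcl [T1 [T2 [P1 _ P2 _ ->]]]; apply: (Pcl _ _ P1 P2).2. Qed.

Lemma modulus_mem P T M : is_modulus T M -> domination_property P ->
  dominated_op P T -> P M.
Proof.
move=> [TM NTM Mleast] Pdom [U [PU TU NTU]].
apply: Pdom PU; first exact: positive_dominating TM NTM.
exact: Mleast.
Qed.

(** The bound [U - T <= U + U] is the inequality [- T <= U] rearranged, so
    the domination property applies below [U + U], which lies in [P]. *)
Lemma dominating_sub_mem P T U : addsub_closed P -> domination_property P ->
  P U -> le_op T U -> le_op (\- T) U -> P (U \- T).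
Proof.
move=> Pcl Pdom PU TU NTU; apply: (Pdom _ (U \+ U)) => //.
  move=> x /NTU /=.
  by rewrite opprK opprB addrACA subrr addr0.
exact: (Pcl _ _ PU PU).1.
Qed.

End Operators.

Theorem proposition1p6p2 (R : realType) (V W : orderedLmodType R)
    (P : set {linear V -> W}) (P_neq0 : P !=set0) (P_addsub : addsub_closed P)
    (T : {linear V -> W}) :
  (regular_op P T <-> dominated_op P T /\ P T) /\
  (forall M : {linear V -> W}, is_modulus T M -> domination_property P ->
     (regular_op P T <-> P M)).
Proof.
split=> [|M modM Pdom]; split.
- by move=> Treg; split; [exact: regular_dominated | exact: regular_mem].
- move=> [[U [PU TU NTU]] PT].
  exact: regular_of_dominating PU (P_addsub _ _ PU PT).2 TU NTU.
- by move=> Treg; apply: modulus_mem modM Pdom _; exact: regular_dominated.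
- move=> PM; have [TM NTM _] := modM.
  exact: regular_of_dominating PM
    (dominating_sub_mem P_addsub Pdom PM TM NTM) TM NTM.
Qed.
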